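(* Let $\mathbb{F}_q$ be a finite field with $q$ elements, $q\neq 2$. Let $n$ and $k$ be positive integers such that $$k<\frac{q^{n/2}-\omega(n)q+q-1}{q-1},$$ where $\omega(n)$ denotes the number of distinct prime divisors of $n$. Then every non-scalar $n\times n$ matrix $A$ over $\mathbb{F}_q$ is a sum of two $k$-th powers, i.e. there exist $n\times n$ matrices $B,C$ over $\mathbb{F}_q$ such that $A=B^k+C^k$.
   Context: A matrix is scalar if it is of the form $\lambda I_n$ with $\lambda\in\mathbb{F}_q$, and non-scalar otherwise. *)

(* Defs.v *)
From mathcomp Require Import all_boot all_order all_algebra.
From mathcomp Require Import reals exp.

Set Implicit Arguments.
Unset Strict Implicit.
Unset Printing Implicit Defensive.

Import Order.TTheory GRing.Theory Num.Theory.

Local Open Scope ring_scope.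

Definition omega (n : nat) : nat := size (primes n).

(* Main.v *)
Require Import Defs.
From HB Require Import structures.
From mathcomp Require Import all_boot all_order all_algebra.
From mathcomp Require Import all_fingroup all_solvable all_field.
From mathcomp Require Import reals exp.
From mathcomp Require Import ring lra zify.

Set Implicit Arguments.
Unset Strict Implicit.
Unset Printing Implicit Defensive.

Import Order.TTheory GRing.Theory Num.Theory.

Local Open Scope ring_scope.

(** Write [q = #|F|], and call [y] in the extension [K] of degree [N] a generator if it has
    [N] distinct conjugates.  If [y = x ^+ k] is a generator then [x] is a polynomial in [y],
    so every matrix whose characteristic polynomial is the minimal polynomial [g] of [y] is a
    [k]-th power; the same holds for [('X - c) g] when [c] is 0 or 1.

    In a basis starting with a vector that is not an eigenvector of [A], put
    [A = [[a, r], [z, A']]] with [z != 0], and look for [C = [[c, *], [0, C']]] and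
    [B = [[a - c, *], [z, A' - C']]].  As [q > 2], [C'] can be chosen with characteristic
    polynomial [g] and such that [(A' - C', z)] is controllable; then the free first row of
    [B] realizes every characteristic polynomial with the right trace.

    It remains to match traces.  A generator that is a [k]-th power exists in degree [n - 1]
    by an order argument.  If [q = 3], both characteristic polynomials can be of the form
    [('X - c) g], since sums of two elements of {0, 1} exhaust [F].  If [q > 3], every [s != 0]
    is the trace of a generator [x ^+ k] of degree [n]: a second moment computation shows that
    [tr (x ^+ k) = s] has about [q ^ (n - 1)] solutions, more than the proper subfields can
    contribute. *)

(** * Determinants and adjugates of bordered matrices *)

(** Schur complement without denominators: right multiplication by a block lower triangular matrix
    of determinant [\det d] clears the block [c]. *)
Lemma det_border (R : idomainType) N (a : R) (b : 'rV_N) (c : 'cV_N) (d : 'M_N) :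
  \det d != 0 ->
  \det (block_mx a%:M b c d) = a * \det d - (b *m \adj d *m c) 0 0.
Proof.
move=> d_neq0; apply: (mulIf d_neq0).
have -> : \det (block_mx a%:M b c d) * \det d =
    \det (block_mx a%:M b c d *m block_mx (\det d)%:M 0 (- (\adj d *m c)) 1%:M).
  by rewrite det_mulmx det_lblock det1 mulr1 det_scalar1.
rewrite mulmx_block !mulmx0 !mulmx1 !add0r !mulmxN.
rewrite [d *m _]mulmxA mul_mx_adj mulmxA !mul_scalar_mx mul_mx_scalar.
rewrite subrr det_ublock; congr (_ * _).
by rewrite det_mx11 !mxE eqxx mulr1n.
Qed.

(** [M] maps the right-hand column to [\det M] times the first basis vector; apply [\adj M] and
    cancel [\det M]. *)
Lemma adj_border (R : idomainType) N (a : R) (b : 'rV_N) (c : 'cV_N) (d : 'M_N) :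
    \det d != 0 -> \det (block_mx a%:M b c d) != 0 ->
  \adj (block_mx a%:M b c d) *m col_mx 1%:M 0 =
  col_mx (\det d)%:M (- (\adj d *m c)).
Proof.
move=> d_neq0; set M := block_mx _ _ _ _; move=> M_neq0.
have MK : M *m col_mx (\det d)%:M (- (\adj d *m c)) = \det M *: col_mx 1%:M 0.
  rewrite mul_block_col !mulmxN mulmxA [d *m _]mulmxA mul_mx_adj !mul_scalar_mx.
  rewrite mul_mx_scalar subrr scale_col_mx scaler0; congr col_mx.
  rewrite det_border // [LHS]mx11_scalar scale_scalar_mx mulr1.
  by rewrite !mxE eqxx mulr1n.
apply/matrixP=> i j; apply: (mulfI M_neq0).
have /matrixP/(_ i j) : \det M *: (\adj M *m col_mx 1%:M 0) =
    \det M *: col_mx (\det d)%:M (- (\adj d *m c)).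
  by rewrite scalemxAr -MK mulmxA mul_adj_mx mul_scalar_mx.
by rewrite !mxE.
Qed.

(** * Controllable pairs and prescribed characteristic polynomials *)

Section Controllability.
Variable F : fieldType.

(* Equivalently, the [D ^+ i *m z] span the whole space. *)
Definition controllable N (D : 'M[F]_N) (z : 'cV[F]_N) :=
  forall p : {poly F}, (size p <= N)%N -> exists y : 'rV[F]_N,
    map_mx polyC y *m \adj (char_poly_mx D) *m map_mx polyC z = p%:M.

Lemma char_poly_mx_border N (a : F) (y : 'rV_N) (z : 'cV_N) (D : 'M[F]_N) :
  char_poly_mx (block_mx a%:M y z D) =
  block_mx ('X - a%:P)%:M (- map_mx polyC y) (- map_mx polyC z) (char_poly_mx D).
Proof.
rewrite /char_poly_mx map_block_mx (scalar_mx_block 1 N) opp_block_mx.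
by rewrite add_block_mx !add0r map_scalar_mx [in RHS]raddfB.
Qed.

Lemma det_char_neq0 N (D : 'M[F]_N) : \det (char_poly_mx D) != 0.
Proof. exact: monic_neq0 (char_poly_monic D). Qed.

Lemma char_poly_border N (a : F) (y : 'rV_N) (z : 'cV_N) (D : 'M[F]_N) :
  char_poly (block_mx a%:M y z D) = ('X - a%:P) * char_poly D -
    (map_mx polyC y *m \adj (char_poly_mx D) *m map_mx polyC z) 0 0.
Proof.
rewrite /char_poly char_poly_mx_border det_border ?det_char_neq0 //.
by rewrite mulNmx mulmxN mulNmx opprK.
Qed.

Lemma controllableZ N (D : 'M[F]_N) z (u : F) :
  u != 0 -> controllable D z -> controllable D (u *: z).
Proof.
move=> u0 Dz p sp; have [y yP] := Dz p sp; exists (u^-1 *: y).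
by rewrite !map_mxZ -!scalemxAl -scalemxAr scalerA -polyCM mulVf // scale1r.
Qed.

(** By [adj_border], the row [(c, y')] yields [c] times [char_poly D] plus what [y'] yields for
    [(D, z)]. So [c] settles the top coefficient of [p], and controllability of [(D, z)] the
    rest. *)
Lemma controllable_border N (a : F) (y : 'rV_N) (z : 'cV_N) (D : 'M[F]_N) :
  controllable D z -> controllable (block_mx a%:M y z D) (col_mx 1%:M 0).
Proof.
move=> Dz p sp; pose c := p`_N.
have [|y' y'P] := Dz (p - c *: char_poly D).
  apply/leq_sizeP => j; rewrite leq_eqVlt => /orP[/eqP <-|ltNj].
    rewrite coefB coefZ /c; have := char_poly_monic D.
    by rewrite monicE lead_coefE size_char_poly => /eqP ->; rewrite mulr1 subrr.
  rewrite coefB coefZ !nth_default ?mulr0 ?subrr ?size_char_poly //.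
  exact: leq_trans sp _.
exists (row_mx c%:M y'); rewrite -mulmxA map_col_mx map_mx1 map_mx0.
rewrite char_poly_mx_border adj_border ?det_char_neq0 //; last first.
  by rewrite -char_poly_mx_border det_char_neq0.
rewrite map_row_mx mul_row_col !mulmxN opprK mulmxA y'P map_scalar_mx.
by rewrite -scalar_mxM -raddfD mul_polyC addrC subrK.
Qed.

Lemma char_poly_mx_conj N (P D : 'M[F]_N) : P \in unitmx ->
  char_poly_mx (P *m D *m invmx P) =
  map_mx polyC P *m char_poly_mx D *m map_mx polyC (invmx P).
Proof.
move=> Pu; rewrite /char_poly_mx !map_mxM mulmxBr mulmxBl; congr (_ - _).
by rewrite scalar_mxC -mulmxA -map_mxM mulmxV // map_mx1 mulmx1.
Qed.

Lemma char_poly_conj N (P D : 'M[F]_N) : P \in unitmx ->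
  char_poly (P *m D *m invmx P) = char_poly D.
Proof.
move=> Pu; rewrite /char_poly char_poly_mx_conj // !det_mulmx mulrAC -det_mulmx.
by rewrite -map_mxM mulmxV // map_mx1 det1 mul1r.
Qed.

Lemma controllable_conj N (P D : 'M[F]_N) z : P \in unitmx ->
  controllable D z -> controllable (P *m D *m invmx P) (P *m z).
Proof.
move=> Pu Dz p /Dz[y yP]; exists (y *m invmx P).
have PK : map_mx polyC (invmx P) *m map_mx polyC P = 1%:M.
  by rewrite -map_mxM mulVmx // map_mx1.
rewrite -yP; set M := char_poly_mx (P *m D *m _).
suff -> : \adj M =
    map_mx polyC P *m \adj (char_poly_mx D) *m map_mx polyC (invmx P).
  rewrite !map_mxM !mulmxA -(mulmxA (map_mx _ y)) PK mulmx1.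
  by rewrite -(mulmxA (map_mx _ y *m _)) PK mulmx1.
(* The adjugate of the conjugate is the conjugate of the adjugate; this is checked after
   multiplication by the nonzero determinant. *)
apply/matrixP=> i j; apply: (mulfI (det_char_neq0 D)).
have /matrixP/(_ i j) : \adj M *m (M *m (map_mx polyC P *m
    \adj (char_poly_mx D) *m map_mx polyC (invmx P))) =
    \det (char_poly_mx D) *: \adj M.
  rewrite {2}/M char_poly_mx_conj // !mulmxA -(mulmxA (_ *m char_poly_mx D)) PK.
  rewrite mulmx1 -(mulmxA _ (char_poly_mx D)) mul_mx_adj mul_mx_scalar.
  by rewrite -!scalemxAl -mulmxA -map_mxM mulmxV // map_mx1 mulmx1.
rewrite mulmxA mul_adj_mx mul_scalar_mx (_ : \det M = \det (char_poly_mx D)).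
  by rewrite !mxE => <-.
exact: (char_poly_conj D Pu).
Qed.

(** In the rank decomposition of [z] the factor [row_ebase z] is a nonzero scalar, which [P]
    absorbs. *)
Lemma mulmx_unit_e1 N (z : 'cV[F]_N.+1) : z != 0 ->
  exists2 P, P \in unitmx & z = P *m (col_mx 1%:M 0 : 'cV_(1 + N)).
Proof.
move=> z0; exists (row_ebase z 0 0 *: col_ebase z).
  rewrite unitmxZ ?col_ebase_unit // unitfE.
  have := row_ebase_unit z; rewrite unitmxE unitfE [row_ebase z]mx11_scalar.
  by rewrite det_scalar1 mxE eqxx mulr1n.
rewrite -{1}(mulmx_ebase z) [row_ebase z]mx11_scalar mul_mx_scalar.
have -> : \rank z = 1%N.
  apply/eqP; rewrite eqn_leq rank_leq_col lt0n mxrank_eq0 //.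
by rewrite (pid_mx_col _ N 1) -scalemxAl !mxE.
Qed.

Hypothesis F_gt2 : exists g : F, (g != 0) && (g != 1).

(** This is how [q > 2] serves the matrix construction: a nonzero [c] is [g *: c + (1 - g) *: c]
    with both coefficients nonzero, and [0] is [u - u]. *)
Lemma col_split N (c : 'cV[F]_N) : exists g b u,
  [/\ (N == 0)%N || (u != 0), g != 0, b != 0 & c = g *: u + b *: u].
Proof.
have [c0|c_nz] := eqVneq c 0.
  exists 1, (-1), (const_mx 1); split; rewrite ?oppr_eq0 ?oner_eq0 //.
    case: N {c c0} => //= n; apply/eqP => /matrixP/(_ 0 0).
    by rewrite !mxE => /eqP; rewrite oner_eq0.
  by rewrite -scalerDl subrr scale0r.
have [g /andP[g0 g1]] := F_gt2; exists g, (1 - g), c; split => //.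
- by rewrite c_nz orbT.
- by rewrite subr_eq0 eq_sym.
- by rewrite -scalerDl addrC subrK scale1r.
Qed.

(** Induction on the size, with [z] moved to the first basis vector. The lower left column of [A] is
    split into nonzero multiples of one [u], and the induction hypothesis for [u] splits the lower
    right block. *)
Lemma controllable_sum N (A : 'M[F]_N) (z : 'cV_N) : (N == 0)%N || (z != 0) ->
  exists C, controllable C z /\ controllable (A - C) z.
Proof.
elim: N => [|N IHN] in A z *.
  move=> _; exists 0; split=> p; rewrite leqn0 size_poly_eq0 => /eqP ->;
  by exists 0; rewrite map_mx0 !mul0mx raddf0.
move=> /= /mulmx_unit_e1[P Pu ->].
set A1 := (invmx P *m A *m P : 'M_(1 + N)).
have [g [b [u [u_nz g_nz b_nz cE]]]] := col_split (dlsubmx A1).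
have [C [Cu ACu]] := IHN (drsubmx A1) u u_nz.
pose C1 : 'M_(1 + N) := block_mx 0%:M 0 (g *: u) C.
have AE : A = P *m A1 *m invmx P.
  by rewrite /A1 !mulmxA mulmxV // mul1mx -mulmxA mulmxV // mulmx1.
exists (P *m C1 *m invmx P); split.
  by apply: controllable_conj => //; apply/controllable_border/controllableZ.
rewrite AE -mulmxBl -mulmxBr; apply: controllable_conj => //.
rewrite -[A1]submxK opp_block_mx add_block_mx.
rewrite cE [_ + _ - _]addrAC subrr add0r.
rewrite [X in block_mx X]mx11_scalar.
by apply/controllable_border/controllableZ.
Qed.

(** With zero first row the characteristic polynomial agrees with [f] in its two top coefficients;
    controllability lets [y] supply the difference. *)
Lemma border_prescribed N (a : F) (z : 'cV_N) (D : 'M[F]_N) f :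
    controllable D z -> f \is monic -> size f = N.+2 -> f`_N = - (a + \tr D) ->
  exists y, char_poly (block_mx a%:M y z D) = f.
Proof.
move=> Dz f_monic sf fN; set h := char_poly (block_mx a%:M (0 : 'rV_N) z D).
have hE : h = ('X - a%:P) * char_poly D.
  by rewrite /h char_poly_border map_mx0 !mul0mx mxE subr0.
have [|y yP] := Dz (h - f); last first.
  by exists y; rewrite char_poly_border yP -hE mxE eqxx mulr1n opprB addrC subrK.
have sh : size h = N.+2 by rewrite size_char_poly.
apply/leq_sizeP => j; rewrite leq_eqVlt => /orP[/eqP <-|].
  have /= := char_poly_trace (block_mx a%:M (0 : 'rV_N) z D) isT.
  rewrite coefB -/h => ->; rewrite fN mxtrace_block mxtrace_scalar mulr1n.
  by rewrite subrr.
rewrite leq_eqVlt => /orP[/eqP <-|ltj]; last first.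
  by rewrite coefB !nth_default ?subrr ?sh ?sf.
have := char_poly_monic (block_mx a%:M (0 : 'rV_N) z D).
rewrite monicE lead_coefE -/h sh coefB => /eqP ->.
by move: f_monic; rewrite monicE lead_coefE sf => /eqP ->; rewrite subrr.
Qed.

(** Same splitting as in [controllable_sum]. Controllability does not depend on the first row, so
    the corner of [C] can fix the trace and the rest of that row can realize [g]. *)
Lemma char_poly_prescribed N (A : 'M[F]_N) (z : 'cV_N) g :
    z != 0 -> g \is monic -> size g = N.+1 ->
  exists2 C, char_poly C = g & controllable (A - C) z.
Proof.
case: N => [|N] in A z *.
  by case/eqP; apply/matrixP => [[]].
move=> /= /mulmx_unit_e1[P Pu ->] g_monic sg.
set A1 := (invmx P *m A *m P : 'M_(1 + N)).
have [x [b [u [u_nz x_nz b_nz cE]]]] := col_split (dlsubmx A1).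
have [C [Cu ACu]] := controllable_sum (drsubmx A1) u_nz.
have [|w wP] := border_prescribed (a := - g`_N - \tr C) (controllableZ x_nz Cu)
  g_monic sg; first by rewrite subrK opprK.
have AE : A = P *m A1 *m invmx P.
  by rewrite /A1 !mulmxA mulmxV // mul1mx -mulmxA mulmxV // mulmx1.
exists (P *m (block_mx (- g`_N - \tr C)%:M w (x *: u) C : 'M_(1 + N)) *m invmx P).
  by rewrite char_poly_conj.
rewrite AE -mulmxBl -mulmxBr; apply: controllable_conj => //.
rewrite -[A1]submxK opp_block_mx add_block_mx.
rewrite cE [_ + _ - _]addrAC subrr add0r.
rewrite [X in block_mx X]mx11_scalar.
by apply/controllable_border/controllableZ.
Qed.

End Controllability.

(** * Splitting a non-scalar matrix *)

Lemma nonscalar_conj (F : finFieldType) N (A : 'M[F]_N.+1) : ~~ is_scalar_mx A ->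
  exists P (A1 : 'M_(1 + N)),
    [/\ P \in unitmx, A = P *m A1 *m invmx P & dlsubmx A1 != 0].
Proof.
move=> A_ns.
(* If every vector were an eigenvector, the basis vectors would make [A] diagonal and the all-ones
   vector would make its diagonal constant. *)
have /existsP[v /andP[v_nz /forallP Av]] :
    [exists v : 'cV[F]_N.+1, (v != 0) && [forall a, A *m v != a *: v]].
  apply: contraR A_ns; rewrite negb_exists => /forallP eigA.
  have {}eigA (v : 'cV[F]_N.+1) : exists a, A *m v = a *: v.
    have [->|v_nz] := eqVneq v 0; first by exists 0; rewrite mulmx0 scaler0.
    have := eigA v; rewrite v_nz negb_forall => /existsP[a].
    by rewrite negbK => /eqP; exists a.
  have [a aP] := eigA (const_mx 1).
  apply/is_scalar_mxP; exists a.
  have diagA i j : i != j -> A i j = 0.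
    move=> i_neq_j; have [b /matrixP/(_ i 0)] := eigA (delta_mx j 0).
    by rewrite -colE !mxE (negPf i_neq_j) mulr0.
  apply/matrixP => i j; rewrite !mxE; have [<-|/diagA -> //] := eqVneq i j.
  move/matrixP/(_ i 0): aP; rewrite !mxE mulr1 => <-.
  rewrite (bigD1 i) //= big1 ?addr0 ?mxE ?mulr1 // => l l_neq_i.
  by rewrite diagA ?mul0r // eq_sym.
have [P Pu vE] := mulmx_unit_e1 v_nz.
exists P, (invmx P *m A *m P); split => //.
  by rewrite !mulmxA mulmxV // mul1mx -mulmxA mulmxV // mulmx1.
set A1 : 'M_(1 + N) := invmx P *m A *m P; apply/negP => /eqP A1_0.
have := Av (ulsubmx A1 0 0); rewrite vE; case/eqP.
have -> : A *m (P *m col_mx 1%:M 0) = P *m (A1 *m col_mx 1%:M 0).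
  by rewrite /A1 !mulmxA mulmxV // mul1mx.
rewrite -[A1 in LHS]submxK mul_block_col !mulmx1 !mulmx0 !addr0 A1_0.
rewrite [ulsubmx A1 in LHS]mx11_scalar -scalemx1.
by rewrite scalemxAr scale_col_mx scaler0.
Qed.

(** The equation on coefficients says that the traces add up. The first row [y] of [B] is
    compensated in [C], whose characteristic polynomial ignores it because [C] is block
    triangular. *)
Lemma sum_prescribed_char_poly (F : finFieldType) N (A : 'M[F]_N.+1) c f g :
    (exists x : F, (x != 0) && (x != 1)) -> ~~ is_scalar_mx A ->
    f \is monic -> size f = N.+2 -> g \is monic -> size g = N.+1 ->
    f`_N + (('X - c%:P) * g)`_N = - \tr A ->
  exists B C, [/\ A = B + C, char_poly B = f & char_poly C = ('X - c%:P) * g].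
Proof.
move=> F_gt2 /nonscalar_conj[P [A1 [Pu -> A1_nz]]] f_monic sf g_monic sg trA.
have [C Cg Dz] := char_poly_prescribed F_gt2 (drsubmx A1) A1_nz g_monic sg.
have gE (y : 'rV_N) : char_poly (block_mx c%:M y 0 C) = ('X - c%:P) * g.
  by rewrite (char_poly_border c y 0 C) map_mx0 mulmx0 mxE subr0 Cg.
have [|y yP] := border_prescribed (a := ulsubmx A1 0 0 - c) Dz f_monic sf.
  apply: (addIr (('X - c%:P) * g)`_N); rewrite trA -(gE 0).
  rewrite (char_poly_trace (block_mx c%:M (0 : 'rV_N) 0 C) isT).
  rewrite mxtrace_mulC mulmxA mulVmx // mul1mx -[A1 in LHS]submxK !mxtrace_block.
  rewrite mxtrace_scalar mulr1n [\tr (ulsubmx _)]/mxtrace big_ord1 linearB /=.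
  by rewrite -opprD; congr (- _); ring.
exists (P *m (block_mx (ulsubmx A1 0 0 - c)%:M y (dlsubmx A1) (drsubmx A1 - C)) *m invmx P).
exists (P *m (block_mx c%:M (ursubmx A1 - y) 0 C) *m invmx P).
split; last 2 first.
- by rewrite char_poly_conj.
- by rewrite char_poly_conj.
rewrite -mulmxDl -mulmxDr add_block_mx addr0 subrK [y + _]addrC subrK.
by rewrite -raddfD /= subrK -mx11_scalar submxK.
Qed.

(** * Extensions of a finite field *)

Lemma natr_card_finField (F : finFieldType) : #|F|%:R = 0 :> F.
Proof. by have := expg_cardG (in_setT (1 : F)); rewrite cardsT FinRing.zmodXgE. Qed.

(** [K] is the splitting field of ['X^Q - 'X], and it consists exactly of the [Q] roots. *)
Lemma finField_extension (F : finFieldType) N : (0 < N)%N ->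
  exists (K : finFieldType) (iota : {rmorphism F -> K}), #|K| = (#|F| ^ N)%N.
Proof.
move=> N_gt0; set Q := (#|F| ^ N)%N.
have F_gt1 : (1 < #|F|)%N := finNzRing_gt1 F.
have Q_gt1 : (1 < Q)%N by rewrite -(exp1n N) ltn_exp2r.
have sz (R : fieldType) : size ('X^Q - 'X : {poly R}) = Q.+1.
  by rewrite size_polyDl size_polyXn // size_polyN size_polyX.
have nz : 'X^Q - 'X != 0 :> {poly F} by rewrite -size_poly_eq0 sz.
have [L [zs split_zs gen_zs]] := FinSplittingFieldFor nz.
have pE : map_poly (in_alg L) ('X^Q - 'X) = 'X^Q - 'X.
  by rewrite rmorphB rmorphXn /= map_polyX.
rewrite pE in split_zs.
pose K := FinFieldExtType L; exists K, (in_alg L : {rmorphism F -> K}).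
have [a _ aE] := finField_galois_generator (sub1v {:L}).
have mem_zs (z : L) : (z \in zs) = (z ^+ Q == z).
  by rewrite -root_prod_XsubC -(eqp_root split_zs) /root !hornerE subr_eq0.
have aN (x : L) : (a ^+ N)%g x = x ^+ Q.
  rewrite /Q; elim: (N) => [|i IHi]; first by rewrite gal_id.
  by rewrite expgSr expnSr exprM galM ?memvf // IHi aE ?memvf // dimv1 expn1.
(* The fixed points of the [N]-th power of Frobenius form a subfield containing the roots, and the
   roots generate [L]. *)
have fixL : fixedSpace (a ^+ N)%g = {:L}%VS.
  apply/eqP; rewrite eqEsubv subvf -gen_zs -[fixedSpace _]subfield_closed agenvS //.
  rewrite subv_add sub1v; apply/span_subvP => x.
  by rewrite mem_zs => /eqP xQ; apply/fixedSpaceP; rewrite aN.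
have Q0 : Q%:R = 0 :> L.
  rewrite -(rmorph_nat (in_alg L)) natrX.
  by rewrite natr_card_finField expr0n gtn_eqF // rmorph0.
(* The roots are distinct because the derivative is [-1]. *)
have uzs : uniq zs.
  rewrite -separable_prod_XsubC -(eqp_separable split_zs) separable_poly.unlock.
  rewrite derivB derivXn derivX -mulr_natr -polyC_natr Q0 mulr0 sub0r.
  by rewrite -[- 1]scaleN1r coprimepZr ?coprimep1 // oppr_eq0 oner_eq0.
suff /eq_card -> : K =i zs.
  apply: succn_inj; rewrite (card_uniqP _) //= -(size_prod_XsubC _ id).
  by rewrite -(eqp_size split_zs) sz.
move=> x; rewrite inE mem_zs -aN.
by apply/esym/eqP/fixedSpaceP; rewrite fixL memvf.
Qed.

(** * Frobenius and trace *)

Section FiniteExtension.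
Variables (F K : finFieldType) (iota : {rmorphism F -> K}) (N : nat).
Local Notation q := #|F|.
Hypothesis cardK : #|K| = (q ^ N)%N.

Lemma pnat_card_finField : (GRing.pchar K).-nat q.
Proof.
have [p p_pr pF] := finPcharP F.
have pK : p \in [pchar K] by rewrite (fmorph_pchar iota).
by rewrite (eq_pnat _ (pcharf_eq pK)); have := pprimeChar_pgroup pF; rewrite /pgroup cardsT.
Qed.

Lemma expfqD i (x y : K) : (x + y) ^+ (q ^ i) = x ^+ (q ^ i) + y ^+ (q ^ i).
Proof. by apply: exprDn_pchar; rewrite pnatX pnat_card_finField. Qed.

Lemma expfq_sum i (I : Type) (r : seq I) (P : pred I) (f : I -> K) :
  (\sum_(j <- r | P j) f j) ^+ (q ^ i) = \sum_(j <- r | P j) f j ^+ (q ^ i).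
Proof.
elim/big_rec2: _ => [|j y z _ <-]; last exact: expfqD.
by rewrite expr0n expn_eq0 -leqn0 leqNgt (ltnW (finNzRing_gt1 F)).
Qed.

Lemma expfq_iota i c : iota c ^+ (q ^ i) = iota c.
Proof.
rewrite -rmorphXn; congr (iota _); elim: i => // i IHi.
by rewrite expnSr exprM IHi expf_card.
Qed.

Lemma expfq_inj i : injective (fun x : K => x ^+ (q ^ i)).
Proof.
move=> x y /= xy; apply/eqP; rewrite -subr_eq0.
have /eqP : (x - y) ^+ (q ^ i) = 0.
  by apply: (addIr (y ^+ (q ^ i))); rewrite -expfqD subrK add0r.
by rewrite expf_eq0 => /andP[].
Qed.

Lemma expfq_fixed (x : K) : x ^+ q = x -> exists c, x = iota c.
Proof.
move=> xq.
have := finField_genPoly F => /(congr1 (map_poly iota)).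
rewrite rmorphB /= map_polyXn map_polyX rmorph_prod /= => /(congr1 (horner^~ x)).
rewrite !hornerE xq subrr horner_prod => /esym/eqP/prodf_eq0[c _].
rewrite map_polyXsubC !hornerE subr_eq0 => /eqP ->; by exists c.
Qed.

(** The field trace, pulled back along [iota]; by [trE] the default [0] only occurs as a true
    value. *)
Definition tr (x : K) : F :=
  odflt 0 [pick c | iota c == \sum_(i < N) x ^+ (q ^ i)].

Lemma trE x : iota (tr x) = \sum_(i < N) x ^+ (q ^ i).
Proof.
rewrite /tr; case: pickP => [c /eqP // | no_c].
have [|c cE] := expfq_fixed (x := \sum_(i < N) x ^+ (q ^ i)); last first.
  by have := no_c c; rewrite cE eqxx.
(* Raising to the power [q] shifts the summands cyclically, since [x ^+ (q ^ N) = x]. *)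
rewrite -[X in _ ^+ X]expn1 expfq_sum; case: N cardK => [|n] cardK'.
  by rewrite !big_ord0.
rewrite big_ord_recr [RHS]big_ord_recl /= addrC; congr (_ + _).
  by rewrite -exprM -expnD addn1 -cardK' expf_card.
by apply: eq_bigr => i _; rewrite -exprM -expnD addn1.
Qed.

Lemma trD x y : tr (x + y) = tr x + tr y.
Proof.
apply: (fmorph_inj iota); rewrite rmorphD !trE -big_split /=.
by apply: eq_bigr => i _; rewrite expfqD.
Qed.

Lemma trZ c x : tr (iota c * x) = c * tr x.
Proof.
apply: (fmorph_inj iota); rewrite rmorphM !trE mulr_sumr.
by apply: eq_bigr => i _; rewrite exprMn expfq_iota.
Qed.

Lemma trN x : tr (- x) = - tr x.
Proof. by rewrite -mulN1r -(rmorphN1 iota) trZ mulN1r. Qed.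

(** * Generators and their minimal polynomials *)

Definition generator (y : K) := [forall j : 'I_N, (0 < j)%N ==> (y ^+ (q ^ j) != y)].

(** The exponents [j] fixing [y] are symmetric under [j -> N - j], as [y ^+ (q ^ N) = y]; so only
    those up to [N / 2] need counting later. *)
Lemma generatorPn y : ~~ generator y ->
  exists j, [/\ (0 < j)%N, (j.*2 <= N)%N & y ^+ (q ^ j) = y].
Proof.
rewrite negb_forall => /existsP[j]; rewrite negb_imply negbK => /andP[j0 /eqP jy].
have [le2j|lt2j] := leqP j.*2 N; first by exists j.
exists (N - j)%N; split; first by rewrite subn_gt0.
  by rewrite -addnn; move: lt2j (ltn_ord j); rewrite -addnn; lia.
apply: (@expfq_inj j); rewrite -exprM -expnD subnK; last exact: ltnW.
by rewrite -cardK expf_card jy.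
Qed.

Lemma expfq_iotaP x : reflect (exists c, x = iota c) (x ^+ q == x).
Proof.
apply: (iffP eqP) => [/expfq_fixed //|[c ->]].
by have := expfq_iota 1 c; rewrite expn1.
Qed.

Definition frobq (x : K) := x ^+ q.

Fact frobq_nmod_morphism : nmod_morphism frobq.
Proof.
split=> [|x y]; last by have := expfqD 1 x y; rewrite expn1.
by rewrite /frobq expr0n gtn_eqF // ltnW // finNzRing_gt1.
Qed.

Fact frobq_monoid_morphism : monoid_morphism frobq.
Proof. by split=> [|x y]; rewrite /frobq ?expr1n ?exprMn. Qed.

HB.instance Definition _ :=
  GRing.isNmodMorphism.Build K K frobq frobq_nmod_morphism.
HB.instance Definition _ :=
  GRing.isMonoidMorphism.Build K K frobq frobq_monoid_morphism.

Lemma map_frobq_iota (h : {poly F}) :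
  map_poly frobq (map_poly iota h) = map_poly iota h.
Proof.
rewrite -map_poly_comp; apply: eq_map_poly => c /=.
by rewrite /frobq; have := expfq_iota 1 c; rewrite expn1.
Qed.

Definition conjugates (y : K) := [seq y ^+ (q ^ i) | i <- seq.iota 0 N].

Lemma root_conjugates (h : {poly F}) y :
  root (map_poly iota h) y -> all (root (map_poly iota h)) (conjugates y).
Proof.
move=> hy; apply/allP => z /mapP[i _ ->]; elim: i => [|i IHi].
  by rewrite expn0 expr1.
rewrite expnSr exprM -/(frobq _) -(map_frobq_iota h) /root horner_map.
by rewrite (eqP IHi) rmorph0.
Qed.

Lemma uniq_conjugates y : generator y -> uniq (conjugates y).
Proof.
move=> /forallP gen_y; rewrite map_inj_in_uniq ?iota_uniq // => i j.
rewrite !mem_iota /= add0n => iN jN; wlog ltij : i j iN jN / (i < j)%N.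
  move=> IH; case: (ltngtP i j) => // ij yij; first exact: IH.
  by apply/esym/IH.
rewrite -(subnK (ltnW ltij)) expnD exprM => /expfq_inj/esym/eqP yij.
have ltjN : (j - i < N)%N by apply: leq_ltn_trans jN; apply: leq_subr.
have := gen_y (Ordinal ltjN); rewrite /= subn_gt0 ltij /=.
by rewrite yij.
Qed.

(** The product over all [N] conjugates, with coefficients pulled back to [F]. It is the minimal
    polynomial when [y] is a generator. *)
Definition min_poly (y : K) : {poly F} :=
  \poly_(i < N.+1)
    odflt 0 [pick c | iota c == (\prod_(z <- conjugates y) ('X - z%:P))`_i].

Lemma map_min_poly y :
  map_poly iota (min_poly y) = \prod_(z <- conjugates y) ('X - z%:P).
Proof.
set P := \prod_(_ <- _) _.
have sP : size P = N.+1 by rewrite size_prod_XsubC size_map size_iota.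
apply/polyP => i; rewrite coef_map coef_poly.
case: ltnP => [_|leNi]; last first.
  by rewrite nth_default ?sP //= rmorph0.
case: pickP => [c /eqP //|no_c].
(* The coefficients are fixed by Frobenius, which permutes the factors cyclically. *)
suff /expfq_iotaP[c cE] : P`_i ^+ q == P`_i by have := no_c c; rewrite cE eqxx.
rewrite -/(frobq _) -coef_map; apply/eqP; congr (_`_i).
rewrite rmorph_prod /= /P /conjugates !big_map.
case: N cardK => [|n] cardK'; first by rewrite !big_nil.
rewrite -{1}[n.+1]addn1 iotaD big_cat big_seq1 /= big_cons mulrC.
rewrite map_polyXsubC; congr (('X - _%:P) * _).
  by rewrite /= /frobq add0n -exprM -expnSr -cardK' expf_card expn0 expr1.
rewrite -[1%N]/(1 + 0)%N iotaDl big_map; apply: eq_bigr => j _.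
by rewrite map_polyXsubC /= /frobq -exprM -expnSr add1n.
Qed.

Lemma min_poly_monic y : min_poly y \is monic.
Proof. by rewrite -(map_monic iota) map_min_poly monic_prod_XsubC. Qed.

Lemma size_min_poly y : size (min_poly y) = N.+1.
Proof.
by rewrite -(size_map_poly iota) map_min_poly size_prod_XsubC size_map size_iota.
Qed.

Lemma min_poly_trace y : (0 < N)%N -> (min_poly y)`_N.-1 = - tr y.
Proof.
move=> N_gt0; apply: (fmorph_inj iota); rewrite -coef_map map_min_poly.
have sc : size (conjugates y) = N by rewrite size_map size_iota.
rewrite -{1}sc coefPn_prod_XsubC; last by rewrite sc -lt0n.
by rewrite rmorphN trE big_map /= -[N in LHS]subn0 -/(index_iota 0 N) big_mkord.
Qed.

Lemma min_poly_dvd y h : generator y -> root (map_poly iota h) y -> min_poly y %| h.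
Proof.
move=> gen_y hy; rewrite -(dvdp_map iota) map_min_poly uniq_roots_dvdp //.
  exact: root_conjugates.
by rewrite uniq_rootsE uniq_conjugates.
Qed.

(** Pigeonhole: evaluation at [y] is injective on polynomials of degree below [N], and there are
    [q ^ N] of them. *)
Lemma generator_poly y x : generator y -> exists p : {poly F}, x = (map_poly iota p).[y].
Proof.
move=> gen_y; pose ev (v : 'rV[F]_N) := (map_poly iota (rVpoly v)).[y].
have ev_inj : injective ev.
  move=> v w /eqP; rewrite -subr_eq0 /ev -hornerN -hornerD -rmorphN -rmorphD /=.
  rewrite -linearB /= => vw0; have {}vw0 := min_poly_dvd gen_y vw0.
  apply: (can_inj rVpolyK); apply/eqP; rewrite -subr_eq0 -linearB /=.
  apply: contraTT vw0 => vw; apply/negP => /(dvdp_leq vw).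
  by rewrite size_min_poly => /leq_trans/(_ (size_poly _ _)); rewrite ltnn.
have [|g _ gK] := inj_card_bij ev_inj.
  by rewrite cardK card_mx mul1n.
by exists (rVpoly (g x)); rewrite -[LHS]gK.
Qed.

Lemma min_poly_expn k (x : K) : generator (x ^+ k) ->
  exists p, min_poly (x ^+ k) %| p ^+ k - 'X.
Proof.
move=> gen_y; have [p pE] := generator_poly x gen_y; exists p.
apply: min_poly_dvd => //; rewrite rmorphB rmorphXn /= map_polyX /root !hornerE.
by rewrite -pE subrr.
Qed.

Lemma min_poly_root_neq0 y c : (1 < N)%N -> generator y -> ~~ root (min_poly y) c.
Proof.
move=> N_gt1 gen_y; apply/negP => yc.
have : root (map_poly iota (min_poly y)) (iota c) by rewrite fmorph_root.
rewrite map_min_poly root_prod_XsubC => /mapP[i _ cE].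
have := forallP gen_y (Ordinal N_gt1); rewrite /= expn1 => /negP; apply.
apply/eqP; apply: (@expfq_inj i); rewrite /= -exprM mulnC exprM -cE.
by have := expfq_iota 1 c; rewrite expn1.
Qed.

Lemma tr0 : tr 0 = 0.
Proof. by have := trZ 0 0; rewrite rmorph0 !mul0r. Qed.

(** * Counting trace fibres *)

(** A point [x0] of the fibre over [s != 0] has multiples whose translations embed this fibre into
    each of the [q] fibres. *)
Lemma card_fiber_le (f : K -> F) (L : {set K}) s :
    (forall x y, f (x + y) = f x + f y) -> (forall c x, f (iota c * x) = c * f x) ->
    (forall x y, x \in L -> y \in L -> x + y \in L) ->
    (forall c x, x \in L -> iota c * x \in L) -> s != 0 ->
  (q * #|[set x in L | f x == s]| <= #|L|)%N.
Proof.
move=> fD fZ LD LZ s_nz; set S := [set x in L | _].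
have -> : #|L| = (\sum_(c : F) #|[set x in L | f x == c]|)%N.
  rewrite -sum1_card (partition_big f xpredT) //=; apply: eq_bigr => c _.
  by rewrite -sum1_card; apply: eq_bigl => x; rewrite inE.
rewrite -sum_nat_const; apply: leq_sum => c _.
have [->|[x0]] := set_0Vmem S; first by rewrite cards0.
rewrite inE => /andP[Lx0 /eqP fx0].
rewrite -(card_imset _ (addrI (iota (c / s - 1) * x0))); apply/subset_leq_card.
apply/subsetP => _ /imsetP[x /[!inE] /andP[Lx /eqP fx] ->].
by rewrite LD ?LZ //= fD fZ fx fx0 mulrBl mul1r subrK divfK.
Qed.

Hypothesis N_gt0 : (0 < N)%N.

Lemma card_tr_fiber_le c : (#|[set x | tr x == c]| <= q ^ N.-1)%N.
Proof.
pose p : {poly K} := \sum_(i < N) 'X^(q ^ i) - (iota c)%:P.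
have q_gt1 : (1 < q)%N := finNzRing_gt1 F.
have sp : size p = (q ^ N.-1).+1.
  rewrite /p; case: N N_gt0 => // n _.
  rewrite big_ord_recr /= addrAC addrC size_polyDl ?size_polyXn //.
  rewrite ltnS (leq_trans (size_polyD _ _)) // size_polyN geq_max.
  rewrite (leq_trans (size_polyC_leq1 _)) ?expn_gt0 ?(ltnW q_gt1) // andbT.
  rewrite (leq_trans (size_sum _ _ _)) //; apply/bigmax_leqP => i _.
  by rewrite size_polyXn ltn_exp2l.
have p_nz : p != 0 by rewrite -size_poly_eq0 sp.
rewrite cardE -ltnS -sp; apply: max_poly_roots => //; last exact: enum_uniq.
apply/allP => x; rewrite mem_enum inE => /eqP trx.
rewrite /root /p !hornerE horner_sum -trx trE subr_eq0.
by apply/eqP/eq_bigr => i _; rewrite hornerXn.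
Qed.

(** The [q] fibres have at most [q ^ N.-1] elements each and [q ^ N] in all, so every bound is
    attained. *)
Lemma card_tr_fiber c : #|[set x | tr x == c]| = (q ^ N.-1)%N.
Proof.
apply/eqP; rewrite eqn_leq card_tr_fiber_le /=.
have : #|K| = (\sum_(c : F) #|[set x | tr x == c]|)%N.
  rewrite -sum1_card (partition_big tr xpredT) //=; apply: eq_bigr => c' _.
  by rewrite -sum1_card; apply: eq_bigl => x; rewrite inE.
rewrite cardK (bigD1 c) //= -(prednK N_gt0) expnS => E.
have : (\sum_(i | i != c) #|[set x | tr x == i]| <= q.-1 * q ^ N.-1)%N.
  apply: leq_trans (leq_sum _ (fun i _ => card_tr_fiber_le i)) _.
  by rewrite sum_nat_const cardC1.
move=> le_rest; rewrite -(leq_add2r (q.-1 * q ^ N.-1)) -mulSn.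
rewrite prednK ?(ltnW (finNzRing_gt1 F)) // E.
by rewrite leq_add2l.
Qed.

Lemma card_tr_mul_fiber (y : K) c : y != 0 -> #|[set a | tr (a * y) == c]| = (q ^ N.-1)%N.
Proof.
move=> y_nz; rewrite -(card_tr_fiber c); set A := [set a | _].
rewrite -(card_imset A (mulIf y_nz)); congr #|pred_of_set _|.
apply/setP => x; rewrite inE; apply/imsetP/idP => [[a /[!inE] trx -> //]|trx].
by exists (x / y); rewrite ?inE divfK.
Qed.

(** Both conditions put [a] in the hyperplane [tr (a * (y - y')) = 0], of which a nonzero value of
    [tr (a * y)] cuts out at most a fraction [1 / q]. *)
Lemma card_tr_mul_fiber2 (y y' : K) (s : F) : y != y' -> s != 0 ->
  (q * #|[set a | (tr (a * y)%R == s) && (tr (a * y')%R == s)]| <= q ^ N.-1)%N.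
Proof.
move=> yy' s_nz; have yy'_nz : y - y' != 0 by rewrite subr_eq0.
rewrite -(card_tr_mul_fiber 0 yy'_nz).
set L := [set a | tr (a * (y - y')) == 0].
apply: leq_trans (card_fiber_le (f := fun a => tr (a * y)) (L := L) (s := s) _ _ _ _ _) => //.
- rewrite leq_mul2l; apply/orP; right; apply/subset_leq_card/subsetP => a.
  rewrite !inE => /andP[/eqP ay /eqP ay'].
  by rewrite mulrBr trD trN ay ay' subrr !eqxx.
- by move=> a b; rewrite mulrDl trD.
- by move=> c a; rewrite -mulrA trZ.
- by move=> a b /[!inE] /eqP a0 /eqP b0; rewrite mulrDl trD a0 b0 addr0.
- by move=> c a /[!inE] /eqP a0; rewrite -mulrA trZ a0 mulr0.
Qed.

(** * Second moment of the number of solutions *)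

Section SecondMoment.
Variables (k : nat) (s : F).
Hypotheses (k_gt0 : (0 < k)%N) (s_nz : s != 0) (N_gt1 : (1 < N)%N).

(** The case of interest is [a = 1]; the twist [a] gives a family to average over. *)
Definition solutions (a : K) := [set x | tr (a * x ^+ k) == s].

Lemma solution_neq0 a x : x \in solutions a -> (a != 0) && (x != 0).
Proof.
rewrite inE; apply: contraTT; rewrite negb_and !negbK.
by case/orP=> /eqP ->; rewrite ?mul0r ?expr0n ?gtn_eqF ?mulr0 ?tr0 // eq_sym.
Qed.

Lemma card_expn_eq_le (y : K) : (#|[set x | x ^+ k == y]| <= k)%N.
Proof.
have sp : size ('X^k - y%:P) = k.+1 by rewrite size_XnsubC.
rewrite cardE -ltnS -sp; apply: max_poly_roots; last exact: enum_uniq.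
  by rewrite -size_poly_eq0 sp.
apply/allP => x; rewrite mem_enum inE => /eqP xk.
by rewrite /root !hornerE xk subrr.
Qed.

Lemma expn_N_pred : (q ^ N.-1 = q ^ N.-2 + q.-1 * q ^ N.-2)%N.
Proof.
have q_gt0 : (0 < q)%N by rewrite ltnW // finNzRing_gt1.
by case: N N_gt1 => [|[|n]] //= _; rewrite -mulSn prednK // expnS.
Qed.

Lemma card_sum_in (T : finType) (A : {pred T}) : #|A| = (\sum_x (x \in A))%N.
Proof. by rewrite -sum1_card big_mkcond. Qed.

Lemma sum_card_solutions :
  (\sum_a #|solutions a| = (q ^ N).-1 * q ^ N.-1)%N.
Proof.
under eq_bigr => a _ do rewrite card_sum_in.
rewrite exchange_big /= (bigD1 0) //= big1 ?add0n; last first.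
  by move=> a _; apply/eqP; rewrite eqb0; apply/negP=> /solution_neq0; rewrite eqxx andbF.
rewrite -cardK -(cardC1 (0 : K)) -sum_nat_const; apply: eq_bigr => x x_nz.
rewrite -(card_tr_mul_fiber s (y := x ^+ k)) ?expf_neq0 // card_sum_in.
by apply: eq_bigr => a _; rewrite !inE.
Qed.

(** The bound is [q ^ N.-2] in general and [q ^ N.-1] when the [k]-th powers agree; writing the
    latter as an excess lets the two parts be summed separately. *)
Lemma card_two_solutions x y :
  (#|[set a | (x \in solutions a) && (y \in solutions a)]| <=
   (x != 0)%R * (y != 0)%R * (q ^ N.-2 + (x ^+ k == y ^+ k)%R * (q.-1 * q ^ N.-2)))%N.
Proof.
have q_gt0 : (0 < q)%N by rewrite ltnW // finNzRing_gt1.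
set A := [set a | _]; have [->|[a]] := set_0Vmem A; first by rewrite cards0.
rewrite inE => /andP[/solution_neq0/andP[_ x_nz] /solution_neq0/andP[_ y_nz]].
rewrite x_nz y_nz !mul1n; have [xy|xy] := eqVneq (x ^+ k) (y ^+ k).
  rewrite mul1n -expn_N_pred -(card_tr_mul_fiber s (expf_neq0 k x_nz)).
  by apply/subset_leq_card/subsetP => b; rewrite !inE => /andP[].
rewrite mul0n addn0 -(leq_pmul2l q_gt0) -expnS prednK ?ltn_predRL //.
apply: leq_trans (card_tr_mul_fiber2 xy s_nz).
by rewrite leq_mul2l; apply/orP; right; apply/subset_leq_card/subsetP => b; rewrite !inE.
Qed.

Lemma sum_card_solutions_sqr :
  (\sum_a #|solutions a| ^ 2 <=
   (q ^ N).-1 * ((q ^ N).-1 * q ^ N.-2 + k * (q.-1 * q ^ N.-2)))%N.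
Proof.
have -> : (\sum_a #|solutions a| ^ 2 = \sum_x \sum_y
    #|[set a | (x \in solutions a) && (y \in solutions a)]|)%N.
  under [RHS]eq_bigr => x _.
    under eq_bigr => y _ do rewrite card_sum_in.
    rewrite exchange_big /=; over.
  rewrite exchange_big /=; apply: eq_bigr => a _; rewrite -mulnn {1}card_sum_in.
  rewrite big_distrl /=; apply: eq_bigr => x _; rewrite card_sum_in big_distrr /=.
  by apply: eq_bigr => y _; rewrite !inE mulnb.
apply: (@leq_trans (\sum_(x : K | x != 0%R) ((q ^ N).-1 * q ^ N.-2 + k * (q.-1 * q ^ N.-2)))).
  rewrite [in leqRHS]big_mkcond; apply: leq_sum => x _.
  apply: leq_trans (leq_sum _ (fun y _ => card_two_solutions x y)) _.
  case: (x != 0); last by rewrite big1 // => y _; rewrite !mul0n.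
  under eq_bigr => y _ do rewrite mul1n mulnDr.
  rewrite big_split leq_add //=.
    rewrite -cardK -(cardC1 (0 : K)) -sum_nat_const [in leqRHS]big_mkcond /=.
    by apply: leq_sum => y _; rewrite inE; case: (y != 0); rewrite ?mul1n.
  apply: leq_trans (_ : #|[set y | y ^+ k == x ^+ k]| * (q.-1 * q ^ N.-2) <= _)%N.
    rewrite card_sum_in big_distrl /=; apply: leq_sum => y _; rewrite inE [y ^+ k == _]eq_sym.
    by case: (y != 0); rewrite ?mul1n.
  by rewrite leq_mul2r card_expn_eq_le orbT.
by rewrite sum_nat_const cardC1 cardK.
Qed.

Lemma solutions_mul_expn x : x != 0 -> #|solutions (x ^+ k)| = #|solutions 1|.
Proof.
move=> x_nz; rewrite -(card_imset (solutions (x ^+ k)) (mulfI x_nz)).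
congr #|pred_of_set _|; apply/setP => y; rewrite inE mul1r.
apply/imsetP/idP => [[z /[!inE] zs ->]|ys]; first by rewrite exprMn.
by exists (x^-1 * y); rewrite ?inE -?exprMn mulVKf.
Qed.

(* The deviation at [a = 1] is shared by all [a = x ^+ k], of which there are at least
   [(q ^ N - 1) / k]; this turns the variance over all [a] into a bound at [1]. *)
Lemma solutions_deviation :
  (#|solutions 1|%:Z - (q ^ N.-1)%:Z) ^+ 2 <= (k ^ 2 * (q.-1 * q ^ N.-2))%:Z.
Proof.
set m := (q ^ N.-1)%N; pose D a := (#|solutions a|%:Z - m%:Z) ^+ 2.
have q_gt0 : (0 < q)%N by rewrite ltnW // finNzRing_gt1.
have Q_gt1 : (1 < q ^ N)%N by rewrite -(exp1n N) ltn_exp2r // finNzRing_gt1.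
have Q1_gt0 : (0 < (q ^ N).-1)%N by rewrite ltn_predRL.
have D_ge0 a : 0 <= D a by rewrite sqr_ge0.
have sum_le : \sum_(a | a != 0) D a <= ((q ^ N).-1 * (k * (q.-1 * q ^ N.-2)))%:Z.
  have n0 : #|solutions 0| = 0%N.
    apply/eqP; rewrite cards_eq0 -subset0; apply/subsetP => x /solution_neq0.
    by rewrite eqxx.
  have S1 : \sum_(a | a != 0) #|solutions a|%:Z = ((q ^ N).-1 * m)%:Z.
    have := sum_card_solutions; rewrite (bigD1 0) //= n0 add0n => <-.
    by rewrite (big_morph Posz PoszD (erefl _)).
  have S2 : \sum_(a | a != 0) #|solutions a|%:Z ^+ 2 <=
      ((q ^ N).-1 * ((q ^ N).-1 * q ^ N.-2 + k * (q.-1 * q ^ N.-2)))%:Z.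
    have := sum_card_solutions_sqr; rewrite (bigD1 0) //= n0 add0n -lez_nat.
    rewrite (big_morph Posz PoszD (erefl _)).
    by under eq_bigr => a _ do rewrite -mulnn PoszM -expr2.
  have -> : \sum_(a | a != 0) D a = \sum_(a | a != 0) #|solutions a|%:Z ^+ 2 -
      m%:Z *+ 2 * ((q ^ N).-1 * m)%:Z + (q ^ N).-1%:Z * m%:Z ^+ 2.
    have -> : (q ^ N).-1%:Z * m%:Z ^+ 2 = \sum_(a : K | a != 0) m%:Z ^+ 2.
      by rewrite sumr_const cardC1 cardK -mulr_natl natz.
    rewrite -S1 mulr_sumr -sumrB -big_split /=; apply: eq_bigr => a _.
    by rewrite /D; ring.
  (* The main terms cancel: [m ^ 2] exceeds [(q ^ N - 1) * q ^ (N - 2)] by [q ^ (N - 2)], so at most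
     the excess of coinciding powers remains. *)
  have QP : (q ^ N * q ^ N.-2 = m * m)%N.
    by rewrite /m -!expnD; congr (_ ^ _)%N; lia.
  have P_gt0 : (0 < q ^ N.-2)%N by rewrite expn_gt0 q_gt0.
  move: S2 QP P_gt0 Q_gt1; set S := \sum_(a | _) _ ^+ 2.
  move: (q ^ N.-2)%N (q ^ N)%N q.-1%N => P [|Q] q1 //=.
  move=> S2 QP _ _; have {QP} : (Q%:Z * (m%:Z * m%:Z) = Q%:Z * (Q%:Z * P%:Z + P%:Z)).
    by rewrite -!(PoszM, PoszD) -QP mulSn addnC.
  move: S2; rewrite !(PoszM, PoszD); move: (Posz m) (Posz q1) (Posz k) => M q2 k2.
  have : 0 <= Q%:Z * P%:Z by rewrite mulr_ge0.
  by move: (Posz Q) (Posz P) => Q2 P2 QP S2 E; nra.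
have sum1 : (q ^ N).-1%:Z * D 1 <= k%:Z * \sum_(a | a != 0) D a.
  have -> : (q ^ N).-1%:Z * D 1 = \sum_(x : K | x != 0) D (x ^+ k).
    rewrite (eq_bigr (fun=> D 1)); last first.
      by move=> x x_nz; rewrite /D solutions_mul_expn.
    by rewrite sumr_const cardC1 cardK -mulr_natl natz.
  rewrite (partition_big (fun x : K => x ^+ k) (fun a => a != 0)) /=; last first.
    by move=> x; apply: expf_neq0.
  rewrite mulr_sumr; apply: ler_sum => a a_nz.
  rewrite (eq_bigr (fun=> D a)); last by move=> x /andP[_ /eqP ->].
  rewrite sumr_const -mulr_natl natz ler_wpM2r // lez_nat.
  apply: leq_trans (card_expn_eq_le a); apply/subset_leq_card/subsetP => x.
  by rewrite !inE => /andP[].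
rewrite -(ler_pM2l (x := (q ^ N).-1%:Z)) ?ltz_nat //.
apply: le_trans sum1 _; apply: le_trans (ler_wpM2l _ sum_le) _ => //.
by rewrite -!PoszM lez_nat; lia.
Qed.

(** * Solutions whose power is not a generator *)

Lemma card_expn_preim_le (P : pred K) :
  (#|[set x | P (x ^+ k)]| <= k * #|[set y | P y]|)%N.
Proof.
rewrite -sum1_card (partition_big (fun x : K => x ^+ k) P) /=; last first.
  by move=> x; rewrite inE.
rewrite mulnC -sum_nat_const big_mkcond [leqRHS]big_mkcond /=.
apply: leq_sum => y _; rewrite inE; case: (P y) => //.
apply: leq_trans (card_expn_eq_le y); rewrite sum1_card; apply/subset_leq_card.
by apply/subsetP => x; rewrite !inE => /andP[].
Qed.

Lemma card_frob_fixed j : (0 < j)%N -> (#|[set y : K | y ^+ (q ^ j) == y]| <= q ^ j)%N.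
Proof.
move=> j_gt0; have q_gt1 : (1 < q ^ j)%N by rewrite -(exp1n j) ltn_exp2r // finNzRing_gt1.
have sp : size ('X^(q ^ j) - 'X : {poly K}) = (q ^ j).+1.
  by rewrite size_polyDl size_polyXn // size_polyN size_polyX.
rewrite cardE -ltnS -sp; apply: max_poly_roots; last exact: enum_uniq.
  by rewrite -size_poly_eq0 sp.
apply/allP => y; rewrite mem_enum inE => /eqP yj.
by rewrite /root !hornerE yj subrr.
Qed.

Lemma card_frob_fixed_fiber j : (0 < j)%N ->
  (q * #|[set y | (y ^+ (q ^ j) == y) && (tr y == s)]| <= q ^ j)%N.
Proof.
move=> j_gt0; apply: leq_trans (card_frob_fixed j_gt0).
apply: leq_trans (card_fiber_le (f := tr) (L := [set y | y ^+ (q ^ j) == y])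
  trD trZ _ _ s_nz).
- by rewrite leq_mul2l; apply/orP; right; apply/subset_leq_card/subsetP => y; rewrite !inE.
- by move=> x y /[!inE] /eqP xj /eqP yj; rewrite expfqD xj yj.
- by move=> c x /[!inE] /eqP xj; rewrite exprMn xj expfq_iota.
Qed.

(** The conjugates repeat with period [j], so the trace is twice a half sum. *)
Lemma tr_frob_half y j : 2%:R = 0 :> F -> N = j.*2 -> y ^+ (q ^ j) = y -> tr y = 0.
Proof.
move=> F2 NE yj; apply: (fmorph_inj iota); rewrite trE rmorph0.
rewrite -(big_mkord xpredT (fun i => y ^+ (q ^ i))) NE -addnn.
rewrite (big_cat_nat (leq0n j)) ?leq_addr //= -{2}[j]add0n big_addn addnK.
under [X in _ + X]eq_bigr => i _ do rewrite addnC expnD exprM yj.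
by rewrite -mulr2n -mulr_natr -(rmorph_nat iota) F2 rmorph0 mulr0.
Qed.

(* Elements [y] fixed by [y |-> y ^+ (q ^ j)] with [j = N / 2] are discarded in
   characteristic 2, where their trace vanishes; without this the bounds fail for [q = 4]. *)
Definition subdegree := if 2%:R == 0 :> F then N.-1./2 else N./2.

(** Union bound over the fixed spaces of Frobenius powers: taking [k]-th roots costs a factor [k],
    the trace condition gains a factor [q]. *)
Lemma card_nongenerator : (forall x, generator (x ^+ k) -> tr (x ^+ k) != s) ->
  (q * #|solutions 1%R| <= k * \sum_(j < subdegree.+1 | 0 < j) q ^ j)%N.
Proof.
move=> no_gen.
pose A (j : nat) := [set x | (fun y => (y ^+ (q ^ j) == y) && (tr y == s)) (x ^+ k)].
have sub : solutions 1 \subset \bigcup_(j < subdegree.+1 | (0 < j)%N) A j.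
  apply/subsetP => x; rewrite inE mul1r => xs.
  have [/no_gen|/generatorPn[j [j_gt0 le2j jx]]] := boolP (generator (x ^+ k)).
    by rewrite xs.
  have lej : (j < subdegree.+1)%N.
    rewrite ltnS /subdegree; case: eqP => [F2|_]; last by rewrite -(doubleK j) half_leq.
    have N2j : N != j.*2.
      by apply: contra_neq s_nz => N2j; rewrite -(eqP xs) (tr_frob_half F2 N2j jx).
    rewrite -(doubleK j) half_leq // -ltnS prednK ?(ltnW N_gt1) //.
    by rewrite ltn_neqAle eq_sym N2j.
  by apply/bigcupP; exists (Ordinal lej); rewrite ?inE //= jx eqxx.
apply: leq_trans (leq_mul (leqnn q) (subset_leq_card sub)) _.
have : (#|\bigcup_(j < subdegree.+1 | (0 < j)%N) A j| <=
    \sum_(j < subdegree.+1 | (0 < j)%N) #|A j|)%N.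
  elim/big_rec2: _ => [|j a B _ leB]; first by rewrite cards0.
  by rewrite (leq_trans (leq_card_setU _ _)) // leq_add2l.
move=> /(leq_mul (leqnn q))/leq_trans; apply.
rewrite !big_distrr /=; apply: leq_sum => j j_gt0.
apply: leq_trans (leq_mul (leqnn q) (card_expn_preim_le _)) _.
by rewrite mulnCA leq_mul2l card_frob_fixed_fiber ?orbT.
Qed.

End SecondMoment.
End FiniteExtension.

(** * From polynomial divisibility to [k]-th powers of matrices *)

(** Chinese remainders: [p] is corrected by a multiple of [g] so as to take the value [c] at [c]. *)
Lemma XsubC_mul_dvd (F : fieldType) k c (g p : {poly F}) :
    ~~ root g c -> c ^+ k = c -> g %| p ^+ k - 'X ->
  exists r, ('X - c%:P) * g %| r ^+ k - 'X.
Proof.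
move=> gc ck gp; exists (p + ((c - p.[c]) / g.[c])%:P * g).
rewrite Gauss_dvdp; last by rewrite coprimep_sym coprimep_XsubC.
rewrite dvdp_XsubCl /root !hornerE.
rewrite divfK // [p.[c] + _]addrC subrK ck subrr eqxx /=.
set r := p + _; have -> : r ^+ k - 'X = (r ^+ k - p ^+ k) + (p ^+ k - 'X).
  by rewrite addrA subrK.
rewrite dvdp_add // subrXX /r.
by rewrite addrC addKr dvdp_mulr ?dvdp_mull.
Qed.

Lemma char_poly_dvd_expn (F : fieldType) N k (A : 'M[F]_N.+1) p :
  char_poly A %| p ^+ k - 'X -> A = (horner_mx A p) ^+ k.
Proof.
case/dvdpP => r /(congr1 (horner_mx A)).
rewrite rmorphM /= Cayley_Hamilton mulr0 rmorphB rmorphXn /= horner_mx_X.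
by move/eqP; rewrite subr_eq0 eq_sym => /eqP.
Qed.

(** * Numerical estimates and existence of generators *)

Lemma sum_expn_geom q m : (0 < q)%N ->
  (q.-1 * (\sum_(j < m.+1 | 0 < j) q ^ j) + q = q ^ m.+1)%N.
Proof.
move=> q_gt0; elim: m => [|m IHm].
  by rewrite big_mkcond big_ord1 /= muln0 expn1.
rewrite big_mkcond big_ord_recr -big_mkcond /= mulnDr -addnA [(_ + q)%N]addnC.
by rewrite addnA IHm -mulSn prednK // -expnS.
Qed.

(* [5 / 16] is the value of [q / (q - 1) ^ 2] at [q = 5]. *)
Lemma deviation_lower_bound q k m X M P : (3 < q)%N ->
    ((k * q.-1) ^ 2 < q * M)%N -> M = (q * P)%N -> (q.-1 * X <= k * q ^ m)%N ->
    (q ^ m * q ^ m <= q * M)%N -> (q = 4 -> 4 * (q ^ m * q ^ m) <= q * M)%N ->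
  (16 * X <= 5 * M)%N /\ (k ^ 2 * (q.-1 * P) < (M - X) ^ 2)%N.
Proof.
case: q => // p; rewrite ltnS /= -!mulnn; move: (p.+1 ^ m)%N => a p_ge3 kp ME pX aM a4.
have X_le : (16 * X <= 5 * M)%N.
  have p2X : (p * p * X <= (k * p) * a)%N by nia.
  have p2X2 : ((p * p * X) * (p * p * X) <= ((k * p) * (k * p)) * (a * a))%N by nia.
  (* For [q = 4] the ratio would be [4 / 9], which is too large; [a4] improves it to [2 / 9]. *)
  have [p3|p_gt3] : p = 3%N \/ (4 <= p)%N by lia.
    have {}a4 : (a * a <= M)%N by have := a4 (congr1 S p3); rewrite p3; lia.
    have : ((9 * X) * (9 * X) < (2 * M) * (2 * M))%N by rewrite p3 in kp p2X2; nia.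
    nia.
  have : ((p * p * X) * (p * p * X) < (p.+1 * M) * (p.+1 * M))%N by nia.
  move=> sq; have lt : (p * p * X < p.+1 * M)%N by nia.
  nia.
split=> //; rewrite ltnNge; apply/negP => le.
(* Here [11 / 16 = 1 - 5 / 16]. Its square exceeds [1 / 3 >= 1 / p], contradicting
   [p * Y ^ 2 < M ^ 2] below. *)
have D : (11 * M <= 16 * (M - X))%N by lia.
move: (M - X)%N D le => Y D le.
have le2 : (p * (Y * Y) <= (k * p) * (k * p) * P)%N by nia.
have P_gt0 : (0 < P)%N by nia.
have lt2 : (p * (Y * Y) < M * M)%N by nia.
nia.
Qed.

Lemma exists_generator_trace (F K : finFieldType) (iota : {rmorphism F -> K}) N k (s : F) :
    #|K| = (#|F| ^ N)%N -> (1 < N)%N -> (0 < k)%N -> (3 < #|F|)%N ->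
    ((k * #|F|.-1) ^ 2 < #|F| ^ N)%N -> s != 0 ->
  exists2 x : K, generator F N (x ^+ k) & tr iota N (x ^+ k) = s.
Proof.
move=> cardK N_gt1 k_gt0 q_gt3 k_lt s_nz; have N_gt0 := ltnW N_gt1.
have q_gt0 : (0 < #|F|)%N by lia.
have [/existsP[x /andP[gen_x /eqP trx]]|no_x] :=
  boolP [exists x : K, generator F N (x ^+ k) && (tr iota N (x ^+ k) == s)].
  by exists x.
exfalso; have no_gen x : generator F N (x ^+ k) -> tr iota N (x ^+ k) != s.
  move=> gen_x; apply: contra no_x => trx; apply/existsP; exists x.
  by rewrite gen_x.
have dev := solutions_deviation iota cardK N_gt0 k_gt0 s_nz N_gt1.
have := card_nongenerator (iota := iota) cardK k_gt0 s_nz N_gt1 no_gen.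
move: dev; set X := #|_|; set m := subdegree F N => dev le_bad.
have qq : (#|F| * #|F| ^ N.-1 = #|F| ^ N)%N by rewrite -expnS prednK.
have [||||||X_le dev_lt] := @deviation_lower_bound #|F| k m X (#|F| ^ N.-1) (#|F| ^ N.-2).
- by [].
- by rewrite qq.
- by rewrite -expnS; congr (_ ^ _)%N; lia.
- have geo := sum_expn_geom m q_gt0; rewrite expnS in geo; nia.
- rewrite qq -expnD leq_pexp2l // /m /subdegree; case: ifP => _; lia.
(* Characteristic 2 makes [2 * m <= N - 1], which saves the factor 4. *)
- move=> q4; rewrite qq.
  have F2 : (2%:R == 0 :> F).
    have := natr_card_finField F.
    by rewrite q4 (natrM _ 2 2) => /eqP; rewrite mulf_eq0 orbb.
  rewrite -{1}q4 -expnD -expnS leq_pexp2l // /m /subdegree F2; lia.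
move: dev; rewrite -opprB sqrrN subzn; last by lia.
by rewrite expr2 -PoszM lez_nat mulnn leqNgt dev_lt.
Qed.

(** Take [x] a primitive element. If [x ^+ k] were fixed by a Frobenius power [j <= N / 2], then
    [q ^ N - 1] would divide [k * (q ^ j - 1)], making [k] at least [q ^ (N - j)]. *)
Lemma exists_generator_expn (F K : finFieldType) (iota : {rmorphism F -> K}) N k :
    #|K| = (#|F| ^ N)%N -> (0 < k)%N -> (2 < #|F|)%N ->
    ((k * #|F|.-1) ^ 2 < #|F| ^ N.+1)%N ->
  exists x : K, generator F N (x ^+ k).
Proof.
move=> cardK k_gt0 q_gt2 k_lt.
have /cyclicP[w wE] := field_unit_group_cyclic [group of [set: {unit K}]].
exists (FinRing.uval w); apply/negPn/negP => /(generatorPn iota cardK)[j [j_gt0 le2j]].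
have ow : #[w]%g = (#|F| ^ N).-1 by rewrite orderE -wE card_finField_unit cardK.
have q1 : (0 < #|F| ^ j)%N by rewrite expn_gt0; lia.
have q_gt0 : (0 < #|F|)%N by lia.
have qj : (2 < #|F| ^ j)%N.
  by apply: leq_trans q_gt2 _; rewrite -[X in (X <= _)%N]expn1 leq_pexp2l.
rewrite -exprM -(prednK q1) mulnS exprD => /eqP.
rewrite -subr_eq0 -{2}[_ ^+ k]mulr1 -mulrBr mulf_eq0 expf_eq0 k_gt0 /=.
have w_nz : FinRing.uval w != 0 by rewrite -unitfE; apply: (valP w).
rewrite (negPf w_nz) /= subr_eq0 -FinRing.val_unitX => /eqP w1.
have : (#[w]%g %| k * (#|F| ^ j).-1)%N.
  by rewrite order_dvdn; apply/eqP/val_inj; rewrite /= w1.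
rewrite ow => /dvdn_leq; rewrite muln_gt0 k_gt0 ltn_predRL (ltnW qj) => /(_ isT).
have NE : (#|F| ^ N = #|F| ^ j * #|F| ^ (N - j))%N by rewrite -expnD; congr (_ ^ _)%N; lia.
have le_ab : (#|F| ^ j <= #|F| ^ (N - j))%N by rewrite leq_pexp2l //; lia.
move: k_lt; rewrite -mulnn expnS NE.
move: le_ab qj; move: (_ ^ j)%N (_ ^ (N - j))%N => a b le_ab a_gt2 k_lt le.
have b_le : (b <= k)%N by nia.
move: q_gt2 k_lt; move: #|F| => q q_gt2 k_lt.
have le1 : (b * q.-1 * (b * q.-1) <= k * q.-1 * (k * q.-1))%N.
  by rewrite leq_mul // leq_mul.
have le2 : (q * (a * b) <= q * (b * b))%N by rewrite leq_mul2l leq_mul ?orbT.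
(* True from [q = 3] on; it absorbs the extra factor [q] in the bound [q ^ N.+1]. *)
have lt3 : (q < q.-1 * q.-1)%N.
  by move: q_gt2; case: (q) => //= p; nia.
have : (q * (b * b) < q.-1 * q.-1 * (b * b))%N by rewrite ltn_mul2r lt3 andbT; nia.
rewrite (mulnACA q.-1) (mulnC q.-1 b); lia.
Qed.

(** * The bound in natural numbers and the final assembly *)

(** As [omega n >= 1], the numerator is at most [q ^ (n / 2) - 1]; squaring removes the real
    exponent. *)
Lemma power_bound_nat (R : realType) (q n k : nat) : (1 < q)%N -> (1 < n)%N ->
    k%:R < (q%:R `^ (n%:R / 2) - (omega n)%:R * q%:R + q%:R - 1) / (q%:R - 1) :> R ->
  ((k * q.-1).+1 ^ 2 < q ^ n)%N.
Proof.
move=> q_gt1 n_gt1; set u := _ `^ _.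
have q1 : q%:R - 1 = (q.-1)%:R :> R by rewrite -subn1 natrB ?(ltnW q_gt1).
have q1_gt0 : 0 < (q.-1)%:R :> R by rewrite ltr0n ltn_predRL.
have u_ge0 : 0 <= u by exact: powR_ge0.
have uu : u * u = (q ^ n)%:R.
  rewrite -powRD; last by apply/implyP => _; rewrite pnatr_eq0 -lt0n ltnW.
  by rewrite -splitr powR_mulrn // natrX.
have om : (1 <= omega n)%N.
  rewrite /omega lt0n size_eq0; apply/eqP => n0.
  have := mem_primes (pdiv n) n.
  by rewrite n0 pdiv_dvd pdiv_prime ?(ltnW n_gt1).
have om' : q%:R <= (omega n)%:R * q%:R :> R by rewrite ler_peMl // ler1n.
rewrite q1 ltr_pdivlMr // => lt.
have lt1 : (k * q.-1).+1%:R < u.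
  rewrite -natr1 natrM -q1 -ltrBrDr; rewrite -q1 in lt; apply: lt_le_trans lt _.
  lra.
rewrite -(ltr_nat R) natrX -uu expr2; apply: ltr_pM => //.
Qed.

Lemma add_bits_card3 (F : finFieldType) (v : F) : #|F| = 3 ->
  exists b c : F, [/\ (b == 0) || (b == 1), (c == 0) || (c == 1) & b + c = v].
Proof.
move=> F3; have F30 : 3%:R = 0 :> F by have := natr_card_finField F; rewrite F3.
have [->|v0] := eqVneq v 0; first by exists 0, 0; rewrite eqxx addr0.
have [->|v1] := eqVneq v 1; first by exists 1, 0; rewrite !eqxx orbT addr0.
have [->|v2] := eqVneq v 2%:R; first by exists 1, 1; rewrite !eqxx orbT.
have two0 : 2%:R != 0 :> F.
  apply/eqP => two0; have := F30; rewrite -addn1 natrD two0 add0r => /eqP.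
  by rewrite oner_eq0.
have : uniq [:: v; 0; 1; 2%:R].
  rewrite /= !inE !negb_or v0 v1 v2 eq_sym oner_eq0 eq_sym two0 /= andbT.
  by rewrite -subr_eq0 -opprB addrK oppr_eq0 oner_eq0.
by move/card_uniqP => E; have := max_card (mem [:: v; 0; 1; 2%:R]); rewrite E F3.
Qed.

Theorem theorem2p10 (R : realType) (F : finFieldType) (n k : nat)
    (hq : #|F| <> 2%N) (hn : (0 < n)%N) (hk : (0 < k)%N)
    (hkn : k%:R < (#|F|%:R `^ (n%:R / 2) - (omega n)%:R * #|F|%:R + #|F|%:R - 1)
                    / (#|F|%:R - 1) :> R)
    (A : 'M[F]_n) (hA : ~~ is_scalar_mx A) :
  exists B C : 'M[F]_n, A = B ^+ k + C ^+ k.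
Proof.
have q_gt1 : (1 < #|F|)%N := finNzRing_gt1 F.
have q_gt2 : (2 < #|F|)%N by rewrite ltn_neqAle eq_sym q_gt1 andbT; apply/eqP.
have n_gt1 : (1 < n)%N.
  rewrite ltn_neqAle hn andbT; apply: contraNN hA => /eqP n1; move: A; rewrite -n1 => M.
  by rewrite [M]mx11_scalar scalar_mx_is_scalar.
have bound := power_bound_nat q_gt1 n_gt1 hkn.
clear hn hkn; case: n => [|[|[|N]]] // in A hA n_gt1 bound *.
  (* For [n = 2] the bound reads [k * (q - 1) + 1 < q], which is impossible. Hence [d = n - 1] is at
     least 2, as [min_poly_root_neq0] requires. *)
  exfalso; move: bound; rewrite ltn_sqr ltnNge => /negP; apply.
  by rewrite -{1}(prednK (ltnW q_gt1)) ltnS leq_pmull.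
pose d := N.+2; rewrite -/d in A hA bound *.
have bound' : ((k * #|F|.-1) ^ 2 < #|F| ^ d.+1)%N.
  by apply: leq_ltn_trans bound; rewrite leq_sqr.
have [K [iota cardK]] := finField_extension F (isT : 0 < d)%N.
have [x gen_x] := exists_generator_expn iota cardK hk q_gt2 bound'.
have [p gp] := min_poly_expn iota cardK gen_x.
set g := min_poly iota d (x ^+ k) in gp.
have g_monic : g \is monic by exact: min_poly_monic.
have sg : size g = d.+1 by exact: size_min_poly.
have XgE c : (('X - c%:P) * g)`_d = g`_d.-1 - c.
  rewrite mulrBl coefB coefXM coefCM /=; congr (_ - _).
  by move: g_monic; rewrite monicE lead_coefE sg => /eqP ->; rewrite mulr1.
have Xg_pow (c : F) : (c == 0) || (c == 1) ->
    exists r, ('X - c%:P) * g %| r ^+ k - 'X.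
  move=> c01; apply: XsubC_mul_dvd gp; first exact: min_poly_root_neq0 gen_x.
  by case/orP: c01 => /eqP ->; rewrite ?expr1n // expr0n gtn_eqF.
have [f [c [f_monic sf c01 [r fr] trE]]] : exists f c, [/\ f \is monic,
    size f = d.+2, (c == 0) || (c == 1), exists r, f %| r ^+ k - 'X &
    f`_d + (('X - c%:P) * g)`_d = - \tr A].
  have [F3|q_neq3] := eqVneq #|F| 3%N.
    have [b [c [b01 c01 bc]]] := add_bits_card3 (g`_d.-1 *+ 2 + \tr A) F3.
    exists (('X - b%:P) * g), c; split=> //.
    - by rewrite monicMl // monicXsubC.
    - by rewrite size_monicM ?monicXsubC ?monic_neq0 // size_XsubC sg.
    - exact: Xg_pow.
    - by rewrite !XgE -[\tr A](addKr (g`_d.-1 *+ 2)) -bc; ring.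
  have q_gt3 : (3 < #|F|)%N by rewrite ltn_neqAle eq_sym q_neq3.
  pose v := \tr A + g`_d.-1.
  (* [f] must have trace [v - c], and [exists_generator_trace] only provides nonzero traces; so [c]
     is 1 exactly when [v = 0]. *)
  pose c : F := (v == 0)%:R.
  have s_nz : v - c != 0.
    rewrite /c; have [v0|v_nz] := eqVneq v 0; last by rewrite subr0.
    by rewrite v0 sub0r oppr_eq0 oner_eq0.
  have [K' [iota' cardK']] := finField_extension F (isT : 0 < d.+1)%N.
  have [y gen_y try] := exists_generator_trace iota' cardK' isT hk q_gt3 bound' s_nz.
  exists (min_poly iota' d.+1 (y ^+ k)), c; split.
  - exact: min_poly_monic.
  - exact: size_min_poly.
  - by rewrite /c; case: (v == 0); rewrite !eqxx ?orbT.
  - have [r rP] := min_poly_expn iota' cardK' gen_y; by exists r.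
  - by rewrite min_poly_trace // try XgE /v; ring.
have F_gt2 : exists z : F, (z != 0) && (z != 1).
  apply/existsP; apply: contraTT q_gt2; rewrite negb_exists => /forallP F01.
  rewrite -leqNgt; apply: leq_trans (_ : #|[set 0%R; 1%R : F]| <= 2)%N.
    by apply/subset_leq_card/subsetP => z _; have := F01 z; rewrite !inE negb_and !negbK.
  by rewrite cards2; case: (_ != _).
have [B [C [-> Bf Cg]]] := sum_prescribed_char_poly F_gt2 hA f_monic sf g_monic sg trE.
have [s gs] := Xg_pow c c01.
exists (horner_mx B r), (horner_mx C s).
by rewrite -!char_poly_dvd_expn ?Bf ?Cg.
Qed.
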